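(* The code $\mathcal C_3(\mathbb D_d)$ is equal to the $\mathbb F_3$-linear code \[ \Big\{\sum_{i=0}^{m-1}\mathrm{Tr}_{2m}\big(b_i t^{(3^m+1)3^i+1}\big)+\sum_{i=0}^{2m-1}\mathrm{Tr}_{2m}\big(b_i' t^{3^i+1}\big)+\sum_{i=0}^{m-1}\mathrm{Tr}_{m}\big(c_i t^{(3^m+1)(3^i+1)}\big)+\mathrm{Tr}_{2m}(bt)+h \;:\; b,b_i,b_i'\in\mathbb F_{3^{2m}},\ c_i\in\mathbb F_{3^m},\ h\in\mathbb F_3\Big\} \] (each element being the function of $t\in\mathbb F_{3^{2m}}$ shown). Moreover, $\mathcal C_3(\mathbb D_d)$ is invariant under all coordinate permutations $t\mapsto s_1t+s_2$ ($s_1\in\mathbb F_{3^{2m}}^*$, $s_2\in\mathbb F_{3^{2m}}$), and consequently for every $w>0$ such that $\mathcal C_3(\mathbb D_d)$ has codewords of Hamming weight $w$, the supports of the codewords of weight $w$ form a $2$-design on the point set $\mathbb F_{3^{2m}}$ (every $2$-subset of $\mathbb F_{3^{2m}}$ is contained in the same number of these supports).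
   Context: Let $m\ge 2$ be an integer and $q=3^{2m}$. For $s\in\{m,2m\}$ let $\mathrm{Tr}_s:\mathbb F_{3^s}\to\mathbb F_3$ denote the absolute trace, $\mathrm{Tr}_s(x)=\sum_{i=0}^{s-1}x^{3^i}$. Vectors in $\mathbb F_3^{q}$ are indexed by the elements of $\mathbb F_{3^{2m}}$; a function $f:\mathbb F_{3^{2m}}\to\mathbb F_3$ is identified with the vector $(f(t))_{t\in\mathbb F_{3^{2m}}}$, and products of such functions are taken pointwise. Let $\mathcal C(2m,3)=\{c(a,b,h): a\in\mathbb F_{3^m}, b\in\mathbb F_{3^{2m}}, h\in\mathbb F_3\}$ where $c(a,b,h)=(\mathrm{Tr}_{2m}(at^{3^m+1}+bt)+h)_{t\in\mathbb F_{3^{2m}}}$; this is a ternary linear code of length $3^{2m}$. Let $d$ be the minimum Hamming weight of a nonzero codeword of $\mathcal C(2m,3)$ (it equals $2\cdot 3^{2m-1}-3^{m-1}$). Let $\mathbb D_d$ be the incidence structure with point set $\mathbb F_{3^{2m}}$ whose blocks are the supports $\{t: c_t\neq 0\}$ of the codewords $c\in\mathcal C(2m,3)$ of weight $d$. Let $\mathcal C_3(\mathbb D_d)$ be the $\mathbb F_3$-linear span in $\mathbb F_3^{\mathbb F_{3^{2m}}}$ of the incidence vectors of the blocks (the incidence vector of a block $B$ has entry $1$ at $t\in B$ and $0$ elsewhere). *)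

(* Defs.v *)
From HB Require Import structures.
From mathcomp Require Import all_boot all_order all_algebra.
Set Implicit Arguments. Unset Strict Implicit. Unset Printing Implicit Defensive.
Import GRing.Theory.
Local Open Scope ring_scope.

(* Ambient field F = F_{3^{2m}} (any finite field with #|F| = 3^(2m)).
   Vectors in F_3^{F} are represented as functions F -> F (finfuns) whose
   values lie in the prime subfield F_3 = {x | x^3 = x} of F. *)

Section Defs.
Variables (F : finFieldType) (m : nat).

Definition vec := {ffun F -> F}.

Definition Tr2m (x : F) : F := \sum_(i < (2 * m)%N) x ^+ (3 ^ i).
Definition Trm (x : F) : F := \sum_(i < m) x ^+ (3 ^ i).

Definition inFm (x : F) : bool := x ^+ (3 ^ m) == x.
Definition inF3 (x : F) : bool := x ^+ 3 == x.

Definition cw (a b h : F) : vec :=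
  [ffun t => Tr2m (a * t ^+ (3 ^ m + 1) + b * t) + h].

Definition Ccode : {set vec} :=
  [set v | [exists a : F, exists b : F, exists h : F,
             [&& inFm a, inF3 h & v == cw a b h]]].

Definition supp (v : vec) : {set F} := [set t | v t != 0].
Definition wt (v : vec) : nat := #|supp v|.

Definition dmin : nat := \big[minn/#|F|]_(v in Ccode | v != 0) wt v.

Definition blocks_d : {set {set F}} :=
  [set supp v | v in [set v in Ccode | wt v == dmin]].

Definition incvec (B : {set F}) : vec := [ffun t => (t \in B)%:R].

(* F_3-linear span: coefficients in F_3 = {0,1,2} acting by k *+ _ *)
Definition span3 (S : {set vec}) : {set vec} :=
  [set v | [exists c : {ffun vec -> 'I_3},
             v == \sum_(u in S) u *+ (nat_of_ord (c u))]].

Definition CD : {set vec} := span3 [set incvec B | B in blocks_d].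

Definition tgtvec (b : F) (bs : {ffun 'I_m -> F}) (bs' : {ffun 'I_(2 * m) -> F})
    (cs : {ffun 'I_m -> F}) (h : F) : vec :=
  [ffun t =>
     \sum_(i < m) Tr2m (bs i * t ^+ ((3 ^ m + 1) * 3 ^ i + 1))
   + \sum_(i < (2 * m)%N) Tr2m (bs' i * t ^+ (3 ^ i + 1))
   + \sum_(i < m) Trm (cs i * t ^+ ((3 ^ m + 1) * (3 ^ i + 1)))
   + Tr2m (b * t) + h].

Definition target : {set vec} :=
  [set v | [exists b : F, exists bs : {ffun 'I_m -> F},
            exists bs' : {ffun 'I_(2 * m) -> F}, exists cs : {ffun 'I_m -> F},
            exists h : F,
              [&& [forall i, inFm (cs i)], inF3 h & v == tgtvec b bs bs' cs h]]].

Definition affperm (s1 s2 : F) (v : vec) : vec := [ffun t => v (s1 * t + s2)].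

Definition blocks_w (w : nat) : {set {set F}} :=
  [set supp v | v in [set v in CD | wt v == w]].

Definition is_2design (Bs : {set {set F}}) : Prop :=
  exists lambda : nat, forall x y : F, x != y ->
    #|[set B in Bs | (x \in B) && (y \in B)]| = lambda.

End Defs.

(* Main.v *)
(* Write q = 3^(2m) and N t = t^(3^m+1), the norm to the subfield of order 3^m.  Completing the
   square turns a codeword with a <> 0 into Tr_2m (a N (t + c)) + h.  The zeros of such words are
   bounded by the degrees of explicit polynomials, and for h = 0, 1, -1 these bounds add up to q,
   so all are attained; hence the minimum weight words are exactly those with a <> 0 and h <> 0,
   and the incidence vector of the support of f is f^2.

   Adding and subtracting the squares for h = 1 and h = -1 and polarizing, the span consists of the
   constants, the forms Tr_2m (a N t) and Tr_2m (b t), and all products of two of these.  The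
   identity Tr x * Tr y = sum_i Tr (x^(3^i) y) places these products in the target code;
   conversely x^(3^i) is recovered from the traces by the power sums
   - x^(3^i) = sum_b b^(3^s-1-3^i) Tr_s (b x), so that every monomial of the target is a sum of such
   products.  The affine group permutes the minimum weight words and is 2-transitive. *)

Require Import Defs.
From HB Require Import structures.
From mathcomp Require Import all_boot all_order all_algebra all_field.
From mathcomp Require Import zify ring.
Import GRing.Theory.
Local Open Scope ring_scope.
Set Implicit Arguments. Unset Strict Implicit. Unset Printing Implicit Defensive.

(** * Traces in characteristic 3 *)

(** Common form of [Tr2m] and [Trm], convertible with both, so that each fact is proved once for s =
    m and s = 2m. *)
Definition trace (R : nzRingType) s (x : R) : R := \sum_(i < s) x ^+ (3 ^ i).

Section Char3.
Variable F : finFieldType.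
Hypothesis char3 : 3%N \in [pchar F].
Implicit Types (x y h : F) (i s : nat).

Lemma char3_nat : 3%:R = 0 :> F.
Proof. exact: pcharf0 char3. Qed.

Lemma exprD3 i x y : (x + y) ^+ (3 ^ i) = x ^+ (3 ^ i) + y ^+ (3 ^ i).
Proof. by apply: exprDn_pchar; rewrite pnatX pnatE ?char3. Qed.

Lemma exprN3 i x : (- x) ^+ (3 ^ i) = - x ^+ (3 ^ i).
Proof. by rewrite exprNn -signr_odd oddX orbT expr1 mulN1r. Qed.

Lemma expr3_sum i (I : Type) (r : seq I) (P : pred I) (f : I -> F) :
  (\sum_(j <- r | P j) f j) ^+ (3 ^ i) = \sum_(j <- r | P j) f j ^+ (3 ^ i).
Proof.
by apply: (big_morph (fun x => x ^+ (3 ^ i)) (exprD3 i)); rewrite expr0n expn_eq0.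
Qed.

Lemma inF3P h : reflect [\/ h = 0, h = 1 | h = -1] (inF3 h).
Proof.
apply: (iffP eqP) => [h3|[]->]; last 1 first.
- by rewrite (exprN3 1) expr1n.
- have : h * ((h - 1) * (h + 1)) = h ^+ 3 - h by ring.
  rewrite h3 subrr.
  move/eqP; rewrite !mulf_eq0 subr_eq0 addr_eq0.
  by case/or3P=> /eqP; [constructor 1 | constructor 2 | constructor 3].
- by rewrite expr0n.
- by rewrite expr1n.
Qed.

Lemma inF3_exp i h : inF3 h -> h ^+ (3 ^ i) = h.
Proof. by move=> /eqP h3; elim: i => [|i IHi]; rewrite ?expr1 // expnS exprM h3. Qed.

Lemma traceD s x y : trace s (x + y) = trace s x + trace s y.
Proof. by rewrite -big_split; apply: eq_bigr => i _; rewrite exprD3. Qed.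

Lemma trace0 s : trace s 0 = 0 :> F.
Proof. by apply: big1 => i _; rewrite expr0n expn_eq0. Qed.

Lemma traceN s x : trace s (- x) = - trace s x.
Proof. by rewrite -sumrN; apply: eq_bigr => i _; rewrite exprN3. Qed.

Lemma trace_sum s (I : Type) (r : seq I) (P : pred I) (f : I -> F) :
  trace s (\sum_(j <- r | P j) f j) = \sum_(j <- r | P j) trace s (f j).
Proof. by apply: (big_morph (trace s) (traceD s) (trace0 s)). Qed.

Lemma traceZ s h x : inF3 h -> trace s (h * x) = h * trace s x.
Proof.
by move=> h3; rewrite mulr_sumr; apply: eq_bigr => i _; rewrite exprMn inF3_exp.
Qed.

Section Fixed.
Variable (s : nat).

(** Cubing rotates the summands cyclically: the last one becomes x^(3^s) = x. *)
Lemma trace_exp3 x : x ^+ (3 ^ s) = x -> trace s (x ^+ 3) = trace s x.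
Proof.
move=> xs; rewrite /trace; case: s xs => [|n] xs; first by rewrite !big_ord0.
rewrite big_ord_recr [RHS]big_ord_recl /= addrC -exprM -expnS xs expn0 expr1.
by congr (_ + _); apply: eq_bigr => i _; rewrite -exprM -expnS.
Qed.

Lemma trace_exp x i : x ^+ (3 ^ s) = x -> trace s (x ^+ (3 ^ i)) = trace s x.
Proof.
move=> xs; elim: i => [|i IHi]; rewrite ?expr1 // expnSr exprM trace_exp3 //.
by rewrite -!exprM mulnC exprM xs.
Qed.

Lemma trace_inF3 x : x ^+ (3 ^ s) = x -> inF3 (trace s x).
Proof.
move=> xs; rewrite /inF3 (expr3_sum 1) -[X in _ == X](trace_exp3 xs) eq_sym.
by apply/eqP/eq_bigr => i _; rewrite -!exprM mulnC.
Qed.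

(** The trace of x is a scalar of F_3, so it moves inside the trace of y and can be expanded
    there. *)
Lemma trace_mul x y : x ^+ (3 ^ s) = x ->
  trace s x * trace s y = \sum_(i < s) trace s (x ^+ (3 ^ i) * y).
Proof. by move=> xs; rewrite -traceZ ?trace_inF3 // mulr_suml trace_sum. Qed.

End Fixed.

Lemma trace_double s x :
  trace (2 * s) x = trace s (x + x ^+ (3 ^ s)).
Proof.
rewrite traceD mul2n -addnn {1}/trace big_split_ord /=; congr (_ + _).
by apply: eq_bigr => i _; rewrite expnD exprM.
Qed.

(** On fixed points of the 3^s-power map both halves of the long trace agree, and 2 = -1. *)
Lemma trace_double_fixed s x : x ^+ (3 ^ s) = x -> trace (2 * s) x = - trace s x.
Proof.
move=> xs; rewrite trace_double xs traceD.
have : 3%:R * trace s x = 0 by rewrite char3_nat mul0r.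
by move=> H; rewrite -[RHS]addr0 -H; ring.
Qed.

End Char3.

(** * Power sums and root counts over a finite field *)

Section FiniteFieldCounts.
Variable F : finFieldType.
Implicit Types (a h : F) (e i n s : nat).

Lemma card_root_le (p : {poly F}) (A : {set F}) n :
  p != 0 -> (size p <= n.+1)%N -> {in A, forall x, root p x} -> (#|A| <= n)%N.
Proof.
move=> p0 sp rA; rewrite cardE -ltnS; apply: leq_trans sp.
apply: max_poly_roots => //; last exact: enum_uniq.
by apply/allP => x; rewrite mem_enum; apply: rA.
Qed.

(** The translation by 1 permutes the field and adds 1 to each of the #|F| summands of the sum of
    all elements. *)
Lemma natr_card : #|F|%:R = 0 :> F.
Proof.
have -> : #|F|%:R = \sum_(b : F) 1 :> F by rewrite sumr_const.
apply: (addrI (\sum_(b : F) b)); rewrite addr0 -big_split.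
by rewrite [RHS](reindex_inj (addIr 1)).
Qed.

Lemma expf_card_pred (x : F) : x != 0 -> x ^+ #|F|.-1 = 1.
Proof.
move=> x0; apply: (mulfI x0); rewrite mulr1 -exprS prednK ?expf_card //.
by apply/card_gt0P; exists x.
Qed.

Lemma sum1_neq0 : \sum_(b : F | b != 0) 1 = -1 :> F.
Proof.
apply: (addrI 1); rewrite subrr; transitivity (#|F|%:R : F); last exact: natr_card.
have -> : #|F|%:R = \sum_(b : F) 1 :> F by rewrite sumr_const.
by rewrite [RHS](bigD1 0).
Qed.

Lemma sum_expf_card_pred : \sum_(b : F) b ^+ #|F|.-1 = -1.
Proof.
rewrite (bigD1 0) //= expr0n gtn_eqF ?add0r; last first.
  by have := finNzRing_gt1 F; case: #|F| => [|[]].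
by rewrite -sum1_neq0; apply: eq_bigr => b /expf_card_pred.
Qed.

(** The bounds say that #|F| - 1 does not divide n, so some g <> 0 has g^n <> 1; the substitution b
    -> g b multiplies the sum by g^n without changing it. *)
Lemma sum_expf_eq0 n :
  (0 < n)%N -> (n < 2 * #|F|.-1)%N -> n != #|F|.-1 -> \sum_(b : F) b ^+ n = 0.
Proof.
move=> n0 n2 nq.
have [g g0 gn] : exists2 g : F, g != 0 & g ^+ n != 1.
  (* r is n reduced modulo #|F| - 1; 'X^r - 1 has too few roots to vanish at all nonzero
     elements. *)
  pose r := if (n < #|F|.-1)%N then n else (n - #|F|.-1)%N.
  have [r0 rq] : (0 < r)%N /\ (r < #|F|.-1)%N.
    rewrite /r; move: #|F|.-1 nq n2 => Q /eqP nq n2; case: (ltnP n) => H; split; lia.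
  have gr (g : F) : g != 0 -> g ^+ n = g ^+ r.
    rewrite /r; case: ltnP => // H g0.
    by rewrite -{1}(subnK H) exprD expf_card_pred // mulr1.
  suff /subsetPn[g] : ~~ ([set~ 0] \subset [set g : F | g ^+ r == 1]).
    by rewrite !inE => g0 gr1; exists g => //; rewrite gr.
  apply: contraTN rq => /subset_leq_card; rewrite cardsC1 -leqNgt => H.
  apply: leq_trans H _; apply: (@card_root_le ('X^r - 1)) => [||x].
  - by rewrite -size_poly_eq0 size_XnsubC.
  - by rewrite size_XnsubC.
  - by rewrite inE /root !hornerE => /eqP->; rewrite subrr.
have : (g ^+ n - 1) * \sum_(b : F) b ^+ n = 0.
  rewrite mulrBl mul1r {2}(reindex_inj (mulfI g0)) mulr_sumr -sumrB.
  by apply: big1 => b _; rewrite exprMn subrr.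
by move/eqP; rewrite mulf_eq0 subr_eq0 (negPf gn) => /eqP.
Qed.

(* The monomial [x ^+ 3 ^ i] is recovered from the linear forms [trace s (b ^+ e * x)]. *)
Lemma sum_expf_trace e s i (x : F) : (e * (3 ^ s).-1)%N = #|F|.-1 -> (i < s)%N ->
  \sum_(b : F) (b ^+ e) ^+ ((3 ^ s).-1 - 3 ^ i) * trace s (b ^+ e * x)
  = - x ^+ (3 ^ i).
Proof.
move=> eq lis; have i3 j : (j < s)%N -> (0 < 3 ^ j <= (3 ^ s).-1)%N.
  by move=> js; rewrite expn_gt0 /= -ltnS prednK ?expn_gt0 ?ltn_exp2l.
have F1 : (0 < #|F|.-1)%N by have := finNzRing_gt1 F; case: #|F| => [|[]].
rewrite /trace; under eq_bigr do rewrite mulr_sumr.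
(* The term j = i has exponent e (3^s - 1) = #|F| - 1, which yields the factor -1. *)
rewrite exchange_big (bigD1 (Ordinal lis)) //= [X in _ + X]big1 => [|j /= ji].
  rewrite addr0 -[RHS]mulN1r -sum_expf_card_pred mulr_suml.
  apply: eq_bigr => b _; rewrite exprMn mulrA -!exprM -exprD -mulnDr subnK ?eq //.
  by case/andP: (i3 _ lis).
have jE : (nat_of_ord j != i) by apply: contra ji => /eqP jE; apply/eqP/val_inj.
(* For j <> i the exponent is positive, below 2 (#|F| - 1) and different from #|F| - 1, so the power
   sum vanishes. *)
rewrite (eq_bigr (fun b => b ^+ (e * ((3 ^ s).-1 - 3 ^ i + 3 ^ j)) * x ^+ (3 ^ j))).
  have nE : (3 ^ j != 3 ^ i)%N by rewrite eqn_exp2l.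
  have := i3 _ lis; have := i3 _ (ltn_ord j).
  move: eq F1 nE; rewrite -mulr_suml.
  move: (3 ^ s).-1%N (3 ^ i)%N (3 ^ j)%N => S3 I3 J3 eq F1 nE J3P I3P.
  by rewrite sum_expf_eq0 ?mul0r // -?eq; nia.
by move=> b _; rewrite exprMn mulrA -!exprM -exprD -mulnDr.
Qed.

(** The trace minus h is a polynomial in t of degree at most e 3^(s-1), nonzero because its value at
    0 is -h. *)
Lemma card_trace_neq0_le e s a h : (0 < e)%N -> (0 < s)%N -> h != 0 ->
  (#|[set t : F | trace s (a * t ^+ e) == h]| <= e * 3 ^ s.-1)%N.
Proof.
move=> e0 s0 h0.
pose p : {poly F} := \sum_(i < s) a ^+ (3 ^ i) *: 'X^(e * 3 ^ i) - h%:P.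
have pE t : p.[t] = trace s (a * t ^+ e) - h.
  rewrite !hornerE horner_sum; congr (_ - _); apply: eq_bigr => i _.
  by rewrite !hornerE exprMn -exprM.
apply: (@card_root_le p) => [||t]; last by rewrite inE /root pE subr_eq0.
- apply: contraNneq h0 => p0; have := pE 0; rewrite p0 horner0.
  rewrite expr0n gtn_eqF // mulr0 /trace big1 => [/eqP|i _].
    by rewrite eq_sym add0r oppr_eq0.
  by rewrite expr0n expn_eq0.
- apply: leq_trans (size_polyD _ _) _; rewrite size_polyN geq_max.
  rewrite (leq_trans (size_polyC_leq1 _)) // andbT.
  apply: leq_trans (size_sum _ _ _) _; apply/bigmax_leqP => i _.
  apply: leq_trans (size_scale_leq _ _) _.
  by rewrite size_polyXn ltnS leq_mul2l leq_exp2l //; have := ltn_ord i; lia.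
Qed.

(** Dividing the trace by t^e lowers the degree by e and leaves the constant term a <> 0; the extra
    1 counts the root t = 0. *)
Lemma card_trace_eq0_le e s a : (0 < e)%N -> (0 < s)%N -> a != 0 ->
  (#|[set t : F | trace s (a * t ^+ e) == 0%R]| <= (e * (3 ^ s.-1).-1).+1)%N.
Proof.
move=> e0 s0 a0.
pose p : {poly F} := \sum_(i < s) a ^+ (3 ^ i) *: 'X^(e * (3 ^ i).-1).
have pE t : t ^+ e * p.[t] = trace s (a * t ^+ e).
  rewrite horner_sum mulr_sumr; apply: eq_bigr => i _.
  rewrite hornerZ hornerXn mulrCA -exprD -mulnS prednK ?expn_gt0 //.
  by rewrite exprMn -exprM.
rewrite (cardsD1 0%R) -add1n; apply: leq_add; first by case: (_ \in _).
apply: (@card_root_le p) => [||t]; last first.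
- rewrite !inE -pE mulf_eq0 => /andP[t0].
  by rewrite (negPf (expf_neq0 _ t0)).
- apply: leq_trans (size_sum _ _ _) _; apply/bigmax_leqP => i _.
  apply: leq_trans (size_scale_leq _ _) _.
  rewrite size_polyXn ltnS leq_mul2l; apply/orP; right.
  by rewrite -!subn1 leq_sub2r // leq_exp2l //; have := ltn_ord i; lia.
- apply: contraNneq a0 => p0; have := horner0 (0 : F); rewrite -p0 horner_sum.
  case: s s0 {pE p0} @p => // s _ _; rewrite big_ord_recl big1 => [|i _].
    by rewrite hornerZ hornerXn /= muln0 expr0 mulr1 addr0 => /eqP.
  have : (1 < 3 ^ (lift ord0 i))%N by rewrite -{1}(expn0 3) ltn_exp2l.
  rewrite hornerZ hornerXn expr0n muln_eq0 (gtn_eqF e0) /=.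
  by case: (3 ^ _)%N => [|[|n]] // _; rewrite mulr0.
Qed.

End FiniteFieldCounts.

(** * Codewords, their weights and the minimum weight *)

Lemma expn3m m : (2 <= m)%N -> (3 ^ m = 3 * 3 ^ m.-1)%N.
Proof. by move=> m2; rewrite -expnS prednK //; lia. Qed.

Lemma expn3_pred_ge3 m : (2 <= m)%N -> (3 <= 3 ^ m.-1)%N.
Proof. by move=> m2; rewrite -{1}(expn1 3) leq_exp2l //; lia. Qed.

Section Code.
Variables (F : finFieldType) (m : nat).
Hypotheses (m_ge2 : (2 <= m)%N) (cardF : #|F| = (3 ^ (2 * m))%N).
Implicit Types (a b c h t x y : F) (v w : vec F).

Lemma pchar3 : 3%N \in [pchar F].
Proof. exact: card_finPcharP cardF isT. Qed.

Let char3 := pchar3.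
(** With 3^m = 3k and #|F| = 9k^2, size comparisons become polynomial inequalities in k, suited to
    [nia]. *)
Local Notation k := (3 ^ m.-1)%N.
Local Notation N t := (t ^+ (3 ^ m + 1)).

Lemma cardFk : #|F| = (9 * k ^ 2)%N.
Proof. by rewrite cardF mulnC expnM (expn3m m_ge2) expnMn. Qed.

(** Provides the instance e = 3^m + 1, s = m of [sum_expf_trace], in which b^e is the norm of b. *)
Lemma cardF_pred : ((3 ^ m + 1) * (3 ^ m).-1)%N = #|F|.-1.
Proof. by rewrite cardFk (expn3m m_ge2); have := expn3_pred_ge3 m_ge2; nia. Qed.

Lemma frob_2m x : x ^+ (3 ^ (2 * m)) = x.
Proof. by rewrite -cardF expf_card. Qed.

Lemma conjK x : (x ^+ (3 ^ m)) ^+ (3 ^ m) = x.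
Proof. by rewrite -exprM -expnD addnn -mul2n frob_2m. Qed.

Lemma norm_inFm t : inFm m (N t).
Proof. by rewrite /inFm exprD expr1 exprMn conjK mulrC. Qed.

Lemma inFmM a b : inFm m a -> inFm m b -> inFm m (a * b).
Proof. by rewrite /inFm exprMn => /eqP-> /eqP->. Qed.

Lemma inFmD a b : inFm m a -> inFm m b -> inFm m (a + b).
Proof. by rewrite /inFm (exprD3 char3) => /eqP-> /eqP->. Qed.

Lemma inFmX a n : inFm m a -> inFm m (a ^+ n).
Proof. by rewrite /inFm -exprM mulnC exprM => /eqP->. Qed.

Lemma inFm1 : inFm m (1 : F).
Proof. by rewrite /inFm expr1n. Qed.

Lemma Tr2m_inF3 x : inF3 (Tr2m m x).
Proof. exact: (trace_inF3 char3) (frob_2m x). Qed.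

Lemma Trm_inF3 x : inFm m x -> inF3 (Trm m x).
Proof. by move=> /eqP; apply: trace_inF3. Qed.

Lemma Tr2m_Trm x : inFm m x -> Tr2m m x = - Trm m x.
Proof. by move=> /eqP; apply: trace_double_fixed. Qed.

Lemma Tr2mD x y : Tr2m m (x + y) = Tr2m m x + Tr2m m y.
Proof. exact: traceD. Qed.

Lemma Tr2mN x : Tr2m m (- x) = - Tr2m m x.
Proof. exact: traceN. Qed.

Lemma Tr2m_conj x : Tr2m m (x ^+ (3 ^ m)) = Tr2m m x.
Proof. exact: trace_exp (frob_2m x). Qed.

Lemma inF3D h1 h2 : inF3 h1 -> inF3 h2 -> inF3 (h1 + h2).
Proof. by rewrite /inF3 (exprD3 char3 1) => /eqP-> /eqP->. Qed.

Lemma inF3N h : inF3 h -> inF3 (- h).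
Proof. by rewrite /inF3 (exprN3 1) => /eqP->. Qed.

(* [N] is the norm to the subfield of order [3 ^ m]; its polarization pairs [t] with
   [c ^+ (3 ^ m)], and the two conjugate terms contribute the factor [2 = -1]. *)
Lemma Tr2m_norm_shift a c t : inFm m a ->
  Tr2m m (a * N (t + c)) =
  Tr2m m (a * N t + - (a * c ^+ (3 ^ m)) * t) + Tr2m m (a * N c).
Proof.
move=> /eqP am.
have cross : Tr2m m (a * t ^+ (3 ^ m) * c) = Tr2m m (a * c ^+ (3 ^ m) * t).
  by rewrite -Tr2m_conj !exprMn am conjK; congr (Tr2m m _); ring.
have -> : a * N (t + c) =
    a * N t + a * c ^+ (3 ^ m) * t + a * t ^+ (3 ^ m) * c + a * N c.
  by rewrite !exprD !expr1 (exprD3 char3); ring.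
rewrite !Tr2mD cross mulNr Tr2mN; set T := Tr2m m (a * _ * t).
by apply/eqP; rewrite -subr_eq0 -(mul0r T) -(char3_nat char3); apply/eqP; ring.
Qed.

(** A codeword after completing the square: c only translates t, so for a in the subfield the weight
    depends on a and h alone. *)
Definition gw a c h : vec F := [ffun t => Tr2m m (a * N (t + c)) + h].

Lemma cw_gw a b h : inFm m a -> a != 0 -> inF3 h ->
  exists c h', inF3 h' /\ cw m a b h = gw a c h'.
Proof.
(* Conjugation is an involution, so this c solves -(a c^(3^m)) = b. *)
move=> am a0 h3; exists (- (b / a) ^+ (3 ^ m)).
exists (h - Tr2m m (a * N (- (b / a) ^+ (3 ^ m)))).
split; first by rewrite inF3D ?inF3N ?Tr2m_inF3.
apply/ffunP => t; rewrite !ffunE Tr2m_norm_shift // exprN3 conjK.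
by rewrite mulrN opprK mulrCA mulfV // mulr1; ring.
Qed.

Lemma gw_cw a c h : inFm m a ->
  gw a c h = cw m a (- (a * c ^+ (3 ^ m))) (h + Tr2m m (a * N c)).
Proof. by move=> am; apply/ffunP=> t; rewrite !ffunE Tr2m_norm_shift //; ring. Qed.

Lemma gw_Ccode a c h : inFm m a -> inF3 h -> gw a c h \in Ccode F m.
Proof.
move=> am h3; rewrite inE gw_cw //; apply/existsP; exists a; apply/existsP.
exists (- (a * c ^+ (3 ^ m))); apply/existsP; exists (h + Tr2m m (a * N c)).
by rewrite am eqxx inF3D ?Tr2m_inF3.
Qed.

Definition zeros v := [set t | v t == 0].

Lemma wt_zeros v : (wt v + #|zeros v| = #|F|)%N.
Proof.
rewrite -(cardsC (zeros v)) addnC /wt; congr (_ + #|pred_of_set _|)%N.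
by apply/setP => t; rewrite !inE.
Qed.

(** After translating by c, the sign in Tr_2m = -Tr_m on the subfield turns the vanishing condition
    into Tr_m = h. *)
Lemma zeros_gw a c h : inFm m a ->
  #|zeros (gw a c h)| = #|[set t : F | trace m (a * t ^+ (3 ^ m + 1)) == h]|.
Proof.
move=> am; rewrite -[RHS](card_preimset _ (addIr c)); congr #|pred_of_set _|.
apply/setP => t; rewrite !inE ffunE Tr2m_Trm ?inFmM ?norm_inFm //.
by rewrite addrC subr_eq0 eq_sym.
Qed.

(** The root bound is (3k + 1)(k - 1) + 1; the strict inequality keeps the words with h = 0 above
    the minimum weight. *)
Lemma card_zeros_le a : inFm m a -> a != 0 ->
  (#|[set t : F | trace m (a * t ^+ (3 ^ m + 1)) == 0%R]| < (3 * k + 1) * k)%N.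
Proof.
move=> am a0; have m0 : (0 < m)%N by lia.
apply: leq_ltn_trans (card_trace_eq0_le _ m0 a0) _; first by rewrite addn1.
by rewrite (expn3m m_ge2); have := expn3_pred_ge3 m_ge2; nia.
Qed.

(* The root bounds for the three values of the trace add up to [#|F|], so all are attained. *)
Lemma card_zeros_eq a h : inFm m a -> a != 0 -> inF3 h -> h != 0 ->
  #|[set t : F | trace m (a * t ^+ (3 ^ m + 1)) == h]| = ((3 * k + 1) * k)%N.
Proof.
move=> am a0 h3 h0; have m0 : (0 < m)%N by lia.
pose Z x := [set t : F | trace m (a * t ^+ (3 ^ m + 1)) == x].
have n0 : (0 < 3 ^ m + 1)%N by rewrite addn1.
have B x : x != 0 -> (#|Z x| <= (3 * k + 1) * k)%N.
  by move=> x0; rewrite -(expn3m m_ge2); apply: card_trace_neq0_le.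
have B0 : (#|Z 0%R| <= ((3 * k + 1) * k.-1).+1)%N.
  by rewrite -(expn3m m_ge2); apply: card_trace_eq0_le.
have : (#|F| <= #|Z 0%R| + #|Z h| + #|Z (- h)%R|)%N.
  rewrite -cardsT; apply: leq_trans (leq_add (leq_card_setU _ _) (leqnn _)).
  apply: leq_trans (leq_card_setU _ _); apply/subset_leq_card/subsetP => t _.
  rewrite !inE; have /inF3P : inF3 (trace m (a * t ^+ (3 ^ m + 1))).
    by apply: Trm_inF3; rewrite inFmM ?norm_inFm.
  case/inF3P: h3 h0 => ->; rewrite ?eqxx // => _ [] ->;
  by rewrite ?opprK eqxx ?orbT.
have := B _ h0; have := B (- h); rewrite oppr_eq0 => /(_ h0).
rewrite -/(Z h) cardFk; have := expn3_pred_ge3 m_ge2; nia.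
Qed.

Definition minword v := exists a c h,
  [/\ inFm m a, a != 0, inF3 h, h != 0 & v = gw a c h].

(** This is 6k^2 - k = 2 * 3^(2m-1) - 3^(m-1), kept as length minus number of zeros. *)
Definition dval := (#|F| - (3 * k + 1) * k)%N.

Lemma dval_gt0 : (0 < dval)%N.
Proof. by rewrite /dval cardFk; have := expn3_pred_ge3 m_ge2; nia. Qed.

Lemma wt_minword v : minword v -> wt v = dval.
Proof.
case=> a [c [h [am a0 h3 h0 ->]]]; rewrite /dval -(card_zeros_eq am a0 h3 h0).
by rewrite -(zeros_gw c) // -(wt_zeros (gw a c h)) addnK.
Qed.

Lemma Ccode_cases v : v \in Ccode F m -> [\/ minword v, v = 0 | (dval < wt v)%N].
Proof.
rewrite inE => /existsP[a /existsP[b /existsP[h /and3P[am h3 /eqP->]]]].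
have lt_dval w : (#|zeros w| < (3 * k + 1) * k)%N -> (dval < wt w)%N.
  by have := wt_zeros w; rewrite /dval cardFk; have := expn3_pred_ge3 m_ge2; nia.
have [a0|a0] := eqVneq a 0; last first.
  have [c [h' [h'3 ->]]] := cw_gw b am a0 h3.
  have [->|h'0] := eqVneq h' 0; last by constructor 1; exists a, c, h'.
  by constructor 3; apply: lt_dval; rewrite zeros_gw ?card_zeros_le.
rewrite {}a0 {am}; have [->|b0] := eqVneq b 0.
  have vE t : cw m 0 0 h t = h by rewrite ffunE !mul0r addr0 [Tr2m _ _]trace0 add0r.
  have [h0|h0] := eqVneq h 0.
    by constructor 2; apply/ffunP => t; rewrite vE ffunE h0.
  constructor 3; apply: lt_dval; rewrite (_ : zeros _ = set0) ?cards0.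
    by have := expn3_pred_ge3 m_ge2; nia.
  by apply/setP => t; rewrite !inE vE (negPf h0).
(* A nonconstant affine word has at most 3^(2m-1) = 3k^2 zeros, fewer than (3k + 1) k. *)
constructor 3; apply: lt_dval; apply: (@leq_ltn_trans (3 ^ (2 * m).-1)); last first.
  have -> : ((2 * m).-1 = m.-1 + m.-1 + 1)%N by lia.
  by rewrite !expnD; have := expn3_pred_ge3 m_ge2; nia.
have -> : zeros (cw m 0 b h) = [set t | trace (2 * m) (b * t ^+ 1) == - h].
  by apply/setP => t; rewrite !inE ffunE mul0r add0r expr1 addr_eq0.
have m0 : (0 < 2 * m)%N by lia.
have [->|h0] := eqVneq h 0.
  apply: leq_trans; first by rewrite oppr0; apply: card_trace_eq0_le.
  by rewrite mul1n prednK ?expn_gt0.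
by rewrite -[X in (_ <= X)%N]mul1n; apply: card_trace_neq0_le; rewrite ?oppr_eq0.
Qed.

Lemma minword_Ccode v : minword v -> v \in Ccode F m.
Proof. by case=> a [c [h [am _ h3 _ ->]]]; apply: gw_Ccode. Qed.

Lemma wt_eq0 v : v = 0 -> wt v = 0%N.
Proof. by move=> ->; apply: eq_card0 => t; rewrite !inE ffunE eqxx. Qed.

Lemma dminE : dmin F m = dval.
Proof.
have mw : minword (gw 1 0 1).
  by exists 1, 0, 1; rewrite inFm1 oner_neq0 /inF3 expr1n eqxx.
apply/eqP; rewrite eqn_leq; apply/andP; split.
  rewrite -(wt_minword mw) /dmin -minEnat -leEnat.
  apply: Order.TotalTheory.bigmin_le_cond; rewrite minword_Ccode //.
  apply/eqP => v0; have := dval_gt0.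
  by rewrite -(wt_minword mw) (wt_eq0 v0).
(* The default value #|F| of the minimum is itself at least [dval]. *)
apply: (big_ind (fun n => dval <= n)%N) => [|x y|v]; first exact: leq_subr.
- by rewrite leq_min => -> ->.
- case/andP => /Ccode_cases[/wt_minword-> // | -> | /ltnW //].
  by rewrite eqxx.
Qed.

Lemma gw_inF3 a c h t : inF3 h -> inF3 (gw a c h t).
Proof. by move=> h3; rewrite ffunE inF3D ?Tr2m_inF3. Qed.

Definition sqv v : vec F := [ffun t => v t ^+ 2].

(** The squares of F_3-valued words are indicators, and weight [dmin] singles out [minword]: other
    nonzero words are heavier, and 0 is excluded since [dval] is positive. *)
Lemma gens_minword u :
  reflect (exists2 v, minword v & u = sqv v)
    (u \in [set incvec B | B in blocks_d F m]).
Proof.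
have incE v : minword v -> incvec (supp v) = sqv v.
  case=> a [c [h [_ _ h3 _ ->]]]; apply/ffunP => t; rewrite [LHS]ffunE [RHS]ffunE inE.
  case/inF3P: (gw_inF3 a c t h3) => ->.
  - by rewrite eqxx expr0n.
  - by rewrite oner_neq0 expr1n.
  - by rewrite oppr_eq0 oner_neq0 sqrrN expr1n.
apply: (iffP imsetP) => [[B /imsetP[v]]|[v mv ->]].
  rewrite inE dminE => /andP[vC /eqP vd] -> ->; exists v; last rewrite incE //;
  by case: (Ccode_cases vC) => // [/wt_eq0|]; have := dval_gt0; rewrite vd; lia.
exists (supp v); last by rewrite incE.
by apply: imset_f; rewrite inE minword_Ccode // wt_minword // dminE eqxx.
Qed.

End Code.

(** * Ternary spans and membership of functions *)

Section Span.
Variable F : finFieldType.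
Hypothesis char3 : 3%N \in [pchar F].
Implicit Types (S : {set vec F}) (v w : vec F) (f g : F -> F).

Lemma vec_mul3 v : v *+ 3 = 0.
Proof. by apply/ffunP => t; rewrite ffunMnE ffunE (mulrn_pchar char3). Qed.

Lemma span3_ind S (P : vec F -> Prop) :
  P 0 -> (forall v w, P v -> P w -> P (v + w)) -> {in S, forall u, P u} ->
  {in span3 S, forall v, P v}.
Proof.
move=> P0 PD PS v; rewrite inE => /existsP[c /eqP->].
apply: big_ind => // u uS; elim: (nat_of_ord (c u)) => [|n IHn]; first by rewrite mulr0n.
by rewrite mulrS; apply: PD => //; apply: PS.
Qed.

(** Scalar multiples over F_3 are repeated sums, so this amounts to being an F_3-subspace. *)
Definition add_stable S := 0 \in S /\ {in S &, forall v w, v + w \in S}.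

Lemma span3_stable S : add_stable (span3 S).
Proof.
split=> [|v w].
  rewrite inE; apply/existsP; exists [ffun=> ord0]; apply/eqP.
  by rewrite big1 // => u _; rewrite ffunE.
rewrite !inE => /existsP[c /eqP->] /existsP[d /eqP->]; apply/existsP.
(* Coefficients add modulo 3; the discarded multiple of 3 annihilates every vector. *)
exists [ffun u => inord ((c u + d u) %% 3)]; apply/eqP; rewrite -big_split.
apply: eq_bigr => u _; rewrite ffunE inordK ?ltn_mod //= -mulrnDr.
by rewrite {1}(divn_eq (c u + d u) 3) mulrnDr mulnC mulrnA vec_mul3 mul0rn add0r.
Qed.

Lemma sub_span3 S : S \subset span3 S.
Proof.
apply/subsetP => u uS; rewrite inE; apply/existsP.
exists [ffun v => if v == u then inord 1 else ord0]; apply/eqP.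
rewrite (bigD1 u) //= big1 => [|v /andP[_ vu]]; last by rewrite ffunE (negPf vu).
by rewrite ffunE eqxx inordK // addr0.
Qed.

(** Membership stated for plain functions, so that pointwise identities transfer it through
    [eq_fun_in]. *)
Definition fun_in S f := [ffun t => f t] \in S.

Lemma eq_fun_in S f g : f =1 g -> fun_in S f -> fun_in S g.
Proof.
by move=> fg; rewrite /fun_in (_ : finfun _ = [ffun t => g t]) //; apply/ffunP=> t; rewrite !ffunE.
Qed.

Section Stable.
Variable S : {set vec F}.
Hypothesis S_stable : add_stable S.

Lemma fun_in0 : fun_in S (fun=> 0).
Proof.
by rewrite /fun_in (_ : finfun _ = 0) ?S_stable.1 //; apply/ffunP => t; rewrite !ffunE.
Qed.

Lemma fun_inD f g : fun_in S f -> fun_in S g -> fun_in S (fun t => f t + g t).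
Proof.
move=> fS gS; have := S_stable.2 _ _ fS gS; congr (_ \in S).
by apply/ffunP => t; rewrite !ffunE.
Qed.

Lemma fun_inN f : fun_in S f -> fun_in S (fun t => - f t).
Proof.
move=> fS; apply: eq_fun_in (fun_inD fS fS) => t.
by apply/eqP; rewrite -subr_eq0 -(mul0r (f t)) -(char3_nat char3); apply/eqP; ring.
Qed.

Lemma fun_inB f g : fun_in S f -> fun_in S g -> fun_in S (fun t => f t - g t).
Proof. by move=> fS gS; apply: fun_inD => //; apply: fun_inN. Qed.

Lemma fun_inZ h f : inF3 h -> fun_in S f -> fun_in S (fun t => h * f t).
Proof.
case/inF3P=> -> fS.
- by apply: eq_fun_in fun_in0 => t; rewrite mul0r.
- by apply: eq_fun_in fS => t; rewrite mul1r.
- by apply: eq_fun_in (fun_inN fS) => t; rewrite mulN1r.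
Qed.

Lemma fun_in_sum (I : Type) (r : seq I) (P : pred I) (f : I -> F -> F) :
  (forall i, P i -> fun_in S (f i)) -> fun_in S (fun t => \sum_(i <- r | P i) f i t).
Proof.
move=> fS; elim: r => [|i r IHr].
  by apply: eq_fun_in fun_in0 => t; rewrite big_nil.
have [Pi|nPi] := boolP (P i).
  by apply: eq_fun_in (fun_inD (fS i Pi) IHr) => t; rewrite big_cons Pi.
by apply: eq_fun_in IHr => t; rewrite big_cons (negPf nPi).
Qed.

End Stable.
End Span.

(** * The target code contains the squares of codewords *)

Section Target.
Variables (F : finFieldType) (m : nat).
Hypotheses (m_ge2 : (2 <= m)%N) (cardF : #|F| = (3 ^ (2 * m))%N).
Implicit Types (a b c h t x y : F) (v w : vec F).
Let char3 := pchar3 cardF.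
Local Notation N t := (t ^+ (3 ^ m + 1)).
Local Notation T := (target F m).

Lemma Tr2m0 : Tr2m m (0 : F) = 0.
Proof. exact: trace0. Qed.

Lemma Trm0 : Trm m (0 : F) = 0.
Proof. exact: trace0. Qed.

Lemma targetP v :
  reflect (exists b (bs : {ffun 'I_m -> F}) (bs' : {ffun 'I_(2 * m) -> F})
                  (cs : {ffun 'I_m -> F}) (h : F),
    [/\ forall i, inFm m (cs i), inF3 h & v = @tgtvec F m b bs bs' cs h])
  (v \in T).
Proof.
rewrite inE; apply: (iffP existsP) => [[b]|[b [bs [bs' [cs [h [csm h3 ->]]]]]]].
  case/existsP=> bs /existsP[bs' /existsP[cs /existsP[h /and3P[/forallP csm h3 /eqP->]]]].
  by exists b, bs, bs', cs, h.
exists b; apply/existsP; exists bs; apply/existsP; exists bs'; apply/existsP.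
exists cs; apply/existsP; exists h; rewrite h3 eqxx andbT.
by rewrite andbT; apply/forallP.
Qed.

Lemma target_stable : add_stable T.
Proof.
split=> [|v w].
  apply/targetP; exists 0, 0, 0, 0, 0; split=> [i||].
  - by rewrite /inFm ffunE expr0n expn_eq0.
  - by rewrite /inF3 expr0n.
  - apply/ffunP => t; rewrite !ffunE !mul0r Tr2m0.
    rewrite !big1 ?addr0 // => i _; by rewrite ffunE mul0r ?Tr2m0 ?Trm0.
case/targetP=> b [bs [bs' [cs [h [csm h3 ->]]]]].
case/targetP=> d [ds [ds' [es [l [esm l3 ->]]]]].
apply/targetP; exists (b + d), (bs + ds), (bs' + ds'), (cs + es), (h + l).
split=> [i||]; first by rewrite ffunE inFmD.
  exact: (inF3D cardF).
apply/ffunP => t; rewrite !ffunE mulrDl (Tr2mD cardF).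
(* One additivity statement serves all three families of monomials. *)
have E n (u u' : {ffun 'I_n -> F}) (p : 'I_n -> F) (tr : F -> F) :
    {morph tr : x y / x + y} ->
    \sum_i tr ((u + u') i * p i) = \sum_i tr (u i * p i) + \sum_i tr (u' i * p i).
  by move=> trD; rewrite -big_split; apply: eq_bigr => i _; rewrite ffunE mulrDl trD.
rewrite !E; try by [exact: Tr2mD | exact: traceD].
by ring.
Qed.

(** Coefficient families supported at one index isolate the single monomials of the target. *)
Lemma sum_dirac n (i : 'I_n) (p : 'I_n -> F) b (tr : F -> F) : tr 0 = 0 ->
  \sum_j tr ([ffun k => if k == i then b else 0] j * p j) = tr (b * p i).
Proof.
move=> tr0; rewrite (bigD1 i) //= big1 => [|j ji].
  by rewrite ffunE eqxx addr0.
by rewrite ffunE (negPf ji) mul0r.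
Qed.

Lemma sum_dirac0 n (p : 'I_n -> F) (tr : F -> F) : tr 0 = 0 ->
  \sum_j tr ((0 : {ffun 'I_n -> F}) j * p j) = 0.
Proof. by move=> tr0; apply: big1 => j _; rewrite ffunE mul0r. Qed.

Let zero_inFm i : inFm m ((0 : {ffun 'I_m -> F}) i).
Proof. by rewrite /inFm ffunE expr0n expn_eq0. Qed.

Let zero_inF3 : inF3 (0 : F).
Proof. by rewrite /inF3 expr0n. Qed.

Lemma target_norm_lin b (i : 'I_m) :
  fun_in T (fun t => Tr2m m (b * t ^+ ((3 ^ m + 1) * 3 ^ i + 1))).
Proof.
apply/targetP; exists 0, [ffun j => if j == i then b else 0], 0, 0, 0; split=> //.
apply/ffunP => t; rewrite !ffunE sum_dirac ?Tr2m0 //.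
by rewrite !sum_dirac0 ?Tr2m0 ?Trm0 // mul0r Tr2m0 !addr0.
Qed.

Lemma target_quad b (i : 'I_(2 * m)) :
  fun_in T (fun t => Tr2m m (b * t ^+ (3 ^ i + 1))).
Proof.
apply/targetP; exists 0, 0, [ffun j => if j == i then b else 0], 0, 0; split=> //.
apply/ffunP => t; rewrite !ffunE sum_dirac ?Tr2m0 //.
by rewrite !sum_dirac0 ?Tr2m0 ?Trm0 // mul0r Tr2m0 !addr0 add0r.
Qed.

Lemma target_norm_quad c (i : 'I_m) : inFm m c ->
  fun_in T (fun t => Trm m (c * t ^+ ((3 ^ m + 1) * (3 ^ i + 1)))).
Proof.
move=> cm; apply/targetP; exists 0, 0, 0, [ffun j => if j == i then c else 0], 0.
split=> // [j|]; first by rewrite ffunE; case: ifP => //; rewrite /inFm expr0n expn_eq0.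
apply/ffunP => t; rewrite !ffunE sum_dirac ?Trm0 //.
by rewrite !sum_dirac0 ?Tr2m0 // mul0r Tr2m0 !addr0 !add0r.
Qed.

Lemma target_lin b : fun_in T (fun t => Tr2m m (b * t)).
Proof.
apply/targetP; exists b, 0, 0, 0, 0; split=> //; apply/ffunP => t.
by rewrite !ffunE !sum_dirac0 ?Tr2m0 ?Trm0 // !addr0 !add0r.
Qed.

Lemma target_const h : inF3 h -> fun_in T (fun=> h).
Proof.
move=> h3; apply/targetP; exists 0, 0, 0, 0, h; split=> //; apply/ffunP => t.
by rewrite !ffunE !sum_dirac0 ?Tr2m0 ?Trm0 // mul0r Tr2m0 !addr0 !add0r.
Qed.

(** The norm is the quadratic monomial t^(3^i + 1) with i = m, an index allowed since m < 2m. *)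
Lemma target_Tr2m_norm a : fun_in T (fun t => Tr2m m (a * N t)).
Proof.
have lt2m : (m < 2 * m)%N by lia.
exact: (target_quad a (Ordinal lt2m)).
Qed.

(** With 2 = -1, (A + L + h)^2 = A^2 + L^2 + h^2 - AL - h(A + L); each product of traces expands
    into one of the three families. *)
Lemma sqv_target a b h : inFm m a -> inF3 h -> sqv (cw m a b h) \in T.
Proof.
move=> am h3; pose A t := Tr2m m (a * N t); pose L t := Tr2m m (b * t).
have LL : fun_in T (fun t => L t * L t).
  have := fun_in_sum target_stable (index_enum _) (P := xpredT)
    (fun (i : 'I_(2 * m)) _ => target_quad (b ^+ (3 ^ i) * b) i).
  apply: eq_fun_in => t /=.
  rewrite /L /Tr2m -!/(trace _ _) (trace_mul char3) ?(frob_2m cardF) //.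
  by apply: eq_bigr => i _; congr (trace _ _); rewrite exprD exprMn expr1; ring.
(* Here -A = Tr_m (a N t) is a scalar of F_3; it is moved inside the trace L and expanded over m
   terms. *)
have AL : fun_in T (fun t => - (A t * L t)).
  have := fun_in_sum target_stable (index_enum _) (P := xpredT)
    (fun (i : 'I_m) _ => target_norm_lin (a ^+ (3 ^ i) * b) i).
  apply: eq_fun_in => t /=.
  have aNm : inFm m (a * N t) by rewrite inFmM ?norm_inFm.
  rewrite /A Tr2m_Trm // mulNr opprK -traceZ ?Trm_inF3 //.
  rewrite /Trm mulr_suml (trace_sum char3); apply: eq_bigr => i _.
  by congr (trace _ _); rewrite exprD exprM exprMn expr1; ring.
have AA : fun_in T (fun t => A t * A t).
  have := fun_in_sum target_stable (index_enum _) (P := xpredT)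
    (fun (i : 'I_m) _ => target_norm_quad i (inFmM (inFmX (3 ^ i) am) am)).
  apply: eq_fun_in => t /=.
  have aNm : inFm m (a * N t) by rewrite inFmM ?norm_inFm.
  rewrite /A Tr2m_Trm // mulrNN /Trm -!/(trace _ _) (trace_mul char3); last exact/eqP.
  by apply: eq_bigr => i _; congr (trace _ _); rewrite mulnDr muln1 exprD exprM exprMn; ring.
have h2 : fun_in T (fun=> h ^+ 2).
  by apply: target_const; case/inF3P: h3 => ->; rewrite /inF3 ?sqrrN ?expr1n ?expr0n.
have hAL : fun_in T (fun t => - (h * (A t + L t))).
  apply: fun_inN => //; first exact: target_stable.
  apply: fun_inZ => //; first exact: target_stable.
  apply: fun_inD; [exact: target_stable|exact: target_Tr2m_norm|exact: target_lin].
have st := target_stable; have D := fun_inD st.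
have := D _ _ (D _ _ (D _ _ LL AA) (D _ _ AL h2)) hAL.
rewrite /fun_in; congr (_ \in T); apply/ffunP => t; rewrite !ffunE (Tr2mD cardF).
rewrite -/(A t) -/(L t); apply/eqP.
(* The two sides differ by 3 times this explicit expression. *)
rewrite -subr_eq0 -(mul0r (- (A t * L t + h * (A t + L t)))) -(char3_nat char3) -subr_eq0.
by apply/eqP; ring.
Qed.

End Target.

(** * The code of the design contains every monomial of the target *)

Section CodeOfDesign.
Variables (F : finFieldType) (m : nat).
Hypotheses (m_ge2 : (2 <= m)%N) (cardF : #|F| = (3 ^ (2 * m))%N).
Implicit Types (a b c h t x y : F) (v w : vec F).
Let char3 := pchar3 cardF.
Local Notation N t := (t ^+ (3 ^ m + 1)).
Local Notation in_CD := (fun_in (CD F m)).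

(** Reduces an identity modulo 3 to [ring] once the cofactor z of 3 is supplied. *)
Lemma eq_mod3 z x y : x - y = 3%:R * z -> x = y.
Proof. by rewrite (char3_nat char3) mul0r => /eqP; rewrite subr_eq0 => /eqP. Qed.

Lemma CD_stable : add_stable (CD F m).
Proof. exact: span3_stable. Qed.

Let CDD := fun_inD CD_stable.
Let CDB := fun_inB char3 CD_stable.
Let CDN := fun_inN char3 CD_stable.
Let CDZ := fun_inZ char3 CD_stable.

Lemma sqv_CD v : minword m v -> sqv v \in CD F m.
Proof.
move=> mv; apply: (subsetP (sub_span3 _)).
by apply/(gens_minword m_ge2 cardF); exists v.
Qed.

Lemma in_CD_shift_sqr a c h : inFm m a -> a != 0 -> inF3 h -> h != 0 ->
  in_CD (fun t => (Tr2m m (a * N (t + c)) + h) ^+ 2).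
Proof.
move=> am a0 h3 h0; have : minword m (gw m a c h) by exists a, c, h.
by move/sqv_CD; congr (_ \in CD F m); apply/ffunP => t; rewrite !ffunE.
Qed.

Let inF3_1 : inF3 (1 : F). Proof. by rewrite /inF3 expr1n. Qed.

(** With T the trace, (T + 1)^2 - (T - 1)^2 = 4T = T and (T + 1)^2 + (T - 1)^2 = -(T^2 + 1). *)
Lemma in_CD_shift_pm a c : inFm m a -> a != 0 ->
  in_CD (fun t => Tr2m m (a * N (t + c))) /\
  in_CD (fun t => Tr2m m (a * N (t + c)) ^+ 2 + 1).
Proof.
move=> am a0; have p := in_CD_shift_sqr c am a0 inF3_1 (oner_neq0 _).
have n : in_CD (fun t => (Tr2m m (a * N (t + c)) + -1) ^+ 2).
  by apply: in_CD_shift_sqr; rewrite ?inF3N // oppr_eq0 oner_neq0.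
split; [move: (CDB p n) | move: (CDN (CDD p n))]; apply: eq_fun_in => t.
  by apply: (eq_mod3 (z := Tr2m m (a * N (t + c)))); ring.
by apply: (eq_mod3 (z := - (Tr2m m (a * N (t + c)) ^+ 2 + 1))); ring.
Qed.

(** By [trace_mul] the sum reduces to power sums of b with exponents (3^m + 1)(3^i + 1); as m >= 2,
    3^i + 1 <= 3^(m-1) + 1 < 3^m - 1, so these stay below #|F| - 1. *)
Lemma sum_Tr2m_norm_sqr t : \sum_(b : F) Tr2m m (N b * N t) ^+ 2 = 0.
Proof.
have fixN (b : F) : inFm m (N b * N t) by rewrite inFmM ?norm_inFm.
pose f (i : 'I_m) (b : F) := Trm m (b ^+ ((3 ^ m + 1) * (3 ^ i + 1)) * N t ^+ (3 ^ i + 1)).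
rewrite (eq_bigr (fun b => \sum_i f i b)) => [|b _]; last first.
  rewrite Tr2m_Trm // sqrrN expr2 /Trm -/(trace _ _) (trace_mul char3); last exact/eqP/fixN.
  apply: eq_bigr => i _; congr (trace _ _).
  by rewrite exprM [N b ^+ _]exprD [N t ^+ (_ + 1)]exprD exprMn !expr1; ring.
rewrite exchange_big big1 // => i _; rewrite /f -(trace_sum char3) -mulr_suml.
have iK : (3 ^ i <= 3 ^ m.-1)%N by rewrite leq_exp2l //; have := ltn_ord i; lia.
have K3 := expn3_pred_ge3 m_ge2; rewrite sum_expf_eq0 ?mul0r ?trace0 //.
- by rewrite muln_gt0 !addn1.
- by rewrite -(cardF_pred m_ge2 cardF) (expn3m m_ge2); nia.
- by rewrite -(cardF_pred m_ge2 cardF) (expn3m m_ge2); nia.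
Qed.

(* [m >= 2] enters here: the sum of the squares vanishes and only the [#|F| - 1]
   constants [1] survive. *)
Lemma in_CD1 : in_CD (fun=> 1).
Proof.
have : in_CD (fun t => \sum_(b : F | b != 0) (Tr2m m (N b * N (t + 0)) ^+ 2 + 1)).
  apply: (fun_in_sum CD_stable) => b b0.
  by apply: (in_CD_shift_pm 0 _ _).2; rewrite ?norm_inFm ?expf_neq0.
move/CDN; apply: eq_fun_in => t; apply: oppr_inj; rewrite opprK addr0 big_split /=.
have := sum_Tr2m_norm_sqr t; rewrite (bigD1 0) //= expr0n addn1 /= mul0r Tr2m0 expr0n add0r => ->.
by rewrite add0r sum1_neq0.
Qed.

Lemma in_CD_const h : inF3 h -> in_CD (fun=> h).
Proof. by move=> h3; have := CDZ h3 in_CD1; apply: eq_fun_in => t; rewrite mulr1. Qed.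

Lemma in_CD_shift a c : inFm m a -> in_CD (fun t => Tr2m m (a * N (t + c))).
Proof.
move=> am; have [->|a0] := eqVneq a 0; last by have [] := in_CD_shift_pm c am a0.
by apply: eq_fun_in (fun_in0 CD_stable) => t; rewrite mul0r Tr2m0.
Qed.

Lemma in_CD_shift_sqr0 a c : inFm m a -> in_CD (fun t => Tr2m m (a * N (t + c)) ^+ 2).
Proof.
move=> am; have [->|a0] := eqVneq a 0.
  by apply: eq_fun_in (fun_in0 CD_stable) => t; rewrite mul0r Tr2m0 expr0n.
have := CDB (in_CD_shift_pm c am a0).2 in_CD1.
by apply: eq_fun_in => t; rewrite addrK.
Qed.

Lemma in_CD_norm a : inFm m a -> in_CD (fun t => Tr2m m (a * N t)).
Proof. by move=> am; have := in_CD_shift 0 am; apply: eq_fun_in => t; rewrite addr0. Qed.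

Lemma in_CD_norm_sqr a : inFm m a -> in_CD (fun t => Tr2m m (a * N t) ^+ 2).
Proof. by move=> am; have := in_CD_shift_sqr0 0 am; apply: eq_fun_in => t; rewrite addr0. Qed.

(** For a <> 0 a suitable translation of the norm form produces any prescribed linear part. *)
Lemma shift_decomp a b : inFm m a -> a != 0 -> exists c h, inF3 h /\
  forall t, Tr2m m (a * N (t + c)) = Tr2m m (a * N t) + Tr2m m (b * t) + h.
Proof.
move=> am a0; exists (- (b / a) ^+ (3 ^ m)), (Tr2m m (a * N (- (b / a) ^+ (3 ^ m)))).
split=> [|t]; first exact: Tr2m_inF3.
rewrite (Tr2m_norm_shift cardF) // exprN3 (conjK cardF) mulrN opprK mulrCA mulfV // mulr1.
by rewrite (Tr2mD cardF).
Qed.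

Lemma in_CD_lin b : in_CD (fun t => Tr2m m (b * t)).
Proof.
have [c [h [h3 E]]] := shift_decomp b (inFm1 F m) (oner_neq0 _).
have := CDB (CDB (in_CD_shift c (inFm1 F m)) (in_CD_norm (inFm1 F m))) (in_CD_const h3).
by apply: eq_fun_in => t; rewrite E; ring.
Qed.

(** Translations with linear parts L and -L give (A + L + h)^2 - (A - L + l)^2, whose leading term
    is 4AL = AL; the rest is already in the span. *)
Lemma in_CD_norm_lin a b : inFm m a ->
  in_CD (fun t => Tr2m m (a * N t) * Tr2m m (b * t)).
Proof.
move=> am; have [->|a0] := eqVneq a 0.
  by apply: eq_fun_in (fun_in0 CD_stable) => t; rewrite mul0r Tr2m0 mul0r.
have [c [h [h3 E]]] := shift_decomp b am a0.
have [d [l [l3 E']]] := shift_decomp (- b) am a0.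
have An := in_CD_norm am; have Lb := in_CD_lin b.
have ab := CDB (CDB (in_CD_shift_sqr0 c am) (in_CD_shift_sqr0 d am))
  (CDB (CDZ l3 (CDB An Lb)) (CDZ h3 (CDD An Lb))).
have := CDB ab (CDB (CDZ h3 (in_CD_const h3)) (CDZ l3 (in_CD_const l3))).
apply: eq_fun_in => t; rewrite E E' mulNr Tr2mN.
set A := Tr2m m (a * _); set L := Tr2m m (b * _).
by apply: (eq_mod3 (z := A * L + h * (A + L) - l * (A - L))); ring.
Qed.

(** All terms of (A + L + h)^2 other than L^2 are known to lie in the span. *)
Lemma in_CD_lin_sqr b : in_CD (fun t => Tr2m m (b * t) ^+ 2).
Proof.
have am := inFm1 F m; have [c [h [h3 E]]] := shift_decomp b am (oner_neq0 _).
have An := in_CD_norm am; have Lb := in_CD_lin b.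
have := CDD (CDB (CDB (in_CD_shift_sqr0 c am) (in_CD_norm_sqr am))
  (CDZ h3 (in_CD_const h3))) (CDD (in_CD_norm_lin b am) (CDZ h3 (CDD An Lb))).
apply: eq_fun_in => t; rewrite E.
set A := Tr2m m (1 * _); set L := Tr2m m (b * _).
by apply: (eq_mod3 (z := A * L + h * (A + L))); ring.
Qed.

(** Polarization: f^2 + g^2 - (f + g)^2 = -2fg = fg. *)
Lemma in_CD_polar (f g : F -> F) :
  in_CD (fun t => (f t + g t) ^+ 2) -> in_CD (fun t => f t ^+ 2) ->
  in_CD (fun t => g t ^+ 2) -> in_CD (fun t => f t * g t).
Proof.
move=> fg ff gg; have := CDB (CDD ff gg) fg; apply: eq_fun_in => t.
by apply: (eq_mod3 (z := - (f t * g t))); ring.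
Qed.

Lemma in_CD_lin_lin b d : in_CD (fun t => Tr2m m (b * t) * Tr2m m (d * t)).
Proof.
apply: in_CD_polar; try exact: in_CD_lin_sqr.
have := in_CD_lin_sqr (b + d); apply: eq_fun_in => t.
by rewrite mulrDl (Tr2mD cardF).
Qed.

Lemma in_CD_norm_norm a b : inFm m a -> inFm m b ->
  in_CD (fun t => Tr2m m (a * N t) * Tr2m m (b * N t)).
Proof.
move=> am bm; apply: in_CD_polar; try exact: in_CD_norm_sqr.
have := in_CD_norm_sqr (inFmD cardF am bm); apply: eq_fun_in => t.
by rewrite mulrDl (Tr2mD cardF).
Qed.

Let sum_CD (f : F -> F -> F) : (forall d, in_CD (f d)) ->
  in_CD (fun t => \sum_(d : F) f d t).
Proof. by move=> fS; apply: (fun_in_sum CD_stable). Qed.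

(** Replacing t^(3^i) by its power sum, with e = 1 and s = 2m, gives minus the sum over d of Tr_2m
    (d t) * Tr_2m (b d^n t). *)
Lemma in_CD_quad b (i : 'I_(2 * m)) : in_CD (fun t => Tr2m m (b * t ^+ (3 ^ i + 1))).
Proof.
have eq : (1 * (3 ^ (2 * m)).-1)%N = #|F|.-1 by rewrite mul1n cardF.
pose n := ((3 ^ (2 * m)).-1 - 3 ^ i)%N.
have := CDN (sum_CD (fun d => in_CD_lin_lin d (b * d ^+ n))).
apply: eq_fun_in => t; rewrite addn1 exprSr -[t ^+ (3 ^ i)]opprK.
rewrite -(sum_expf_trace t eq (ltn_ord i)) mulNr mulrN Tr2mN; congr (- _).
rewrite mulr_suml mulr_sumr [RHS](trace_sum char3); apply: eq_bigr => d _.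
rewrite expr1 -/n -[LHS](traceZ _ _ (Tr2m_inF3 cardF (d * t))).
by congr (trace _ _); rewrite -[Tr2m m (d * t)]/(trace (2 * m) (d * t)); ring.
Qed.

(** The same expansion applied to (N t)^(3^i), with s = m; its minus sign cancels against Tr_m =
    -Tr_2m. *)
Lemma in_CD_norm_mul_lin b (i : 'I_m) :
  in_CD (fun t => Tr2m m (b * t ^+ ((3 ^ m + 1) * 3 ^ i + 1))).
Proof.
pose n := ((3 ^ m).-1 - 3 ^ i)%N.
have := sum_CD (fun d => in_CD_norm_lin (b * N d ^+ n) (norm_inFm cardF d)).
apply: eq_fun_in => t; rewrite [t ^+ (_ * _ + _)]exprD exprM expr1 -[N t ^+ (3 ^ i)]opprK.
rewrite -(sum_expf_trace (N t) (cardF_pred m_ge2 cardF) (ltn_ord i)) -sumrN.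
rewrite mulr_suml mulr_sumr [RHS](trace_sum char3); apply: eq_bigr => d _.
have dm : inFm m (N d * N t) by rewrite inFmM ?norm_inFm.
rewrite -/n -/(Trm m (N d * N t)) -mulrN -Tr2m_Trm //.
rewrite -[LHS](traceZ _ _ (Tr2m_inF3 cardF (N d * N t))).
by congr (trace _ _); ring.
Qed.

(** Both factors are now traces of subfield elements, since c (N d)^n stays there; their two signs
    cancel and the minus of the power sum remains. *)
Lemma in_CD_norm_quad c (i : 'I_m) : inFm m c ->
  in_CD (fun t => Trm m (c * t ^+ ((3 ^ m + 1) * (3 ^ i + 1)))).
Proof.
move=> cm; pose n := ((3 ^ m).-1 - 3 ^ i)%N.
have dm d : inFm m (c * N d ^+ n) := inFmM cm (inFmX n (norm_inFm cardF d)).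
have := CDN (sum_CD (fun d => in_CD_norm_norm (norm_inFm cardF d) (dm d))).
apply: eq_fun_in => t; rewrite exprM [(3 ^ i + 1)%N]addn1 exprSr -[N t ^+ (3 ^ i)]opprK.
rewrite -(sum_expf_trace (N t) (cardF_pred m_ge2 cardF) (ltn_ord i)) -sumrN -sumrN.
rewrite mulr_suml mulr_sumr [RHS](trace_sum char3); apply: eq_bigr => d _.
have dtm : inFm m (N d * N t) by rewrite inFmM ?norm_inFm.
have cm' : inFm m (c * N d ^+ n * N t) by rewrite inFmM ?norm_inFm.
rewrite -/n -/(Trm m (N d * N t)) [Tr2m m (c * _ * _)]Tr2m_Trm //.
rewrite mulrN opprK -[LHS](traceZ _ _ (Tr2m_inF3 cardF (N d * N t))).
by rewrite Tr2m_Trm //; congr (trace _ _); rewrite -[Trm m (N d * N t)]/(trace m _); ring.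
Qed.

Lemma CD_target : CD F m = target F m.
Proof.
have T := target_stable cardF.
apply/setP/subset_eqP/andP; split; apply/subsetP.
  apply: span3_ind; [exact: T.1 | exact: T.2 |].
  move=> u /(gens_minword m_ge2 cardF)[v mv ->].
  case: mv => a [c [h [am _ h3 _ ->]]]; rewrite gw_cw //.
  by apply: sqv_target => //; apply: (inF3D cardF h3); apply: Tr2m_inF3.
move=> v /targetP[b [bs [bs' [cs [h [csm h3 ->]]]]]].
apply: CDD (in_CD_const h3); apply: CDD (in_CD_lin b).
apply: CDD; last by apply: (fun_in_sum CD_stable) => i _; apply: in_CD_norm_quad.
apply: CDD; last by apply: (fun_in_sum CD_stable) => i _; apply: in_CD_quad.
by apply: (fun_in_sum CD_stable) => i _; apply: in_CD_norm_mul_lin.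
Qed.

(** * Affine invariance and the 2-designs *)

Lemma CD_affine s1 s2 v : s1 != 0 -> v \in CD F m -> affperm s1 s2 v \in CD F m.
Proof.
move=> s0; move: v; apply: span3_ind => [|v w vC wC|u].
- have := CD_stable.1; congr (_ \in CD F m); by apply/ffunP => t; rewrite !ffunE.
- have := CD_stable.2 _ _ vC wC; congr (_ \in CD F m).
  by apply/ffunP => t; rewrite !ffunE.
move=> /(gens_minword m_ge2 cardF)[v [a [c [h [am a0 h3 h0 ->]]]] ->].
(* s1 t + s2 + c = s1 (t + (s2 + c) / s1), and N s1 factors out into the coefficient a. *)
have := @sqv_CD (gw m (a * N s1) ((s2 + c) / s1) h).
rewrite (_ : sqv _ = affperm s1 s2 (sqv (gw m a c h))).
  apply; exists (a * N s1), ((s2 + c) / s1), h; split=> //; first by rewrite inFmM ?norm_inFm.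
  by rewrite mulf_neq0 ?expf_neq0.
apply/ffunP => t; rewrite !ffunE; congr ((Tr2m m _ + h) ^+ 2).
by rewrite -mulrA -exprMn mulrDr mulrCA mulfV // mulr1 addrA.
Qed.

Definition blocks_thru (w : nat) x y : {set {set F}} :=
  [set B in blocks_w F m w | (x \in B) && (y \in B)].

(** Preimage under the affine map embeds the blocks through the image pair into those through x and
    y; the reverse inequality comes from the inverse map. *)
Lemma card_blocks_thru_affine s1 s2 (w : nat) x y : s1 != 0 ->
  (#|blocks_thru w (s1 * x + s2)%R (s1 * y + s2)%R| <= #|blocks_thru w x y|)%N.
Proof.
move=> s0; pose f t := s1 * t + s2.
have fI : injective f by move=> t u /addIr/(mulfI s0).
have fS (B : {set F}) : f @: (f @^-1: B) = B.
  apply/setP => t; apply/imsetP/idP => [[u]|tB]; first by rewrite inE => ? ->.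
  by exists ((t - s2) / s1); rewrite ?inE /f mulrCA mulfV // mulr1 subrK.
(* [preimset f] takes a membership predicate, hence the composition with [mem]; the image map is a
   left inverse. *)
have pI : injective (preimset f \o (fun B : {set F} => mem B)).
  exact: (can_inj (g := fun B : {set F} => f @: B)).
rewrite -(card_imset _ pI); apply/subset_leq_card/subsetP => _ /imsetP[B + ->] /=.
rewrite inE => /andP[/imsetP[v]]; rewrite inE => /andP[vC /eqP vw] -> /andP[xB yB].
move: xB yB; rewrite -[s1 * x + s2]/(f x) -[s1 * y + s2]/(f y) !inE => -> ->.
rewrite !andbT; apply/imsetP; exists (affperm s1 s2 v).
  rewrite inE CD_affine //= -vw /wt -(card_preimset (supp v) fI); apply/eqP.
  by congr #|pred_of_set _|; apply/setP => t; rewrite !inE ffunE.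
by apply/setP => t; rewrite !inE ffunE.
Qed.

(** The map t -> (y - x) t + x sends the reference pair 0, 1 to x, y; it and its inverse give the
    two inequalities. *)
Lemma blocks_w_2design (w : nat) : is_2design (blocks_w F m w).
Proof.
exists #|blocks_thru w 0 1| => x y xy; rewrite -/(blocks_thru w x y).
have s0 : y - x != 0 by rewrite subr_eq0 eq_sym.
apply/eqP; rewrite eqn_leq; apply/andP; split.
  have := card_blocks_thru_affine x w 0 1 s0.
  by rewrite mulr0 add0r mulr1 subrK.
have := card_blocks_thru_affine (- x / (y - x)) w x y (invr_neq0 s0).
by rewrite ![(y - x)^-1 * _]mulrC -!mulrDl subrr mul0r mulfV.
Qed.

End CodeOfDesign.

Theorem theorem3p15 (F : finFieldType) (m : nat) :
  (2 <= m)%N -> #|F| = (3 ^ (2 * m))%N ->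
  [/\ CD F m = target F m,
      (forall (s1 s2 : F) (v : vec F), s1 != 0 ->
         v \in CD F m -> affperm s1 s2 v \in CD F m)
    & (forall w : nat, (0 < w)%N ->
         (exists2 v, v \in CD F m & wt v = w) -> is_2design (blocks_w F m w))].
Proof.
move=> m2 cardF; split=> [|s1 s2 v|w _ _].
- exact: CD_target.
- exact: CD_affine.
- exact: blocks_w_2design.
Qed.
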